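(* Let $d>k\geq 1$ be integers. Let $p$ be an odd prime such that $p\nmid dk(d-k)$, and let $q=p^r$ with $r\geq 1$. For $\lambda\in\mathbb{F}_q^\times$, let $r_q(\lambda)$ and $r_q'(\lambda)$ be the number of distinct zeros in $\mathbb{F}_q$ of $f_\lambda(y)=y^{d-k}(1-y)^k-(d\lambda)^{-d}$ and $g_\lambda(y)=y^d-d\lambda y^k+1$, respectively. If $\gcd(d,k)=1$, then $r_q'(\lambda)=r_q(\lambda)$.
   Context: $\mathbb{F}_q$ is the finite field with $q$ elements; $f_\lambda$ and $g_\lambda$ are polynomials in $\mathbb{F}_q[y]$. *)

(* Defs.v *)
From HB Require Import structures.
From mathcomp Require Import all_boot all_order all_algebra all_field.

Set Implicit Arguments.
Unset Strict Implicit.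
Unset Printing Implicit Defensive.

Import GRing.Theory.
Local Open Scope ring_scope.

Definition f_poly (F : fieldType) (d k : nat) (lam : F) : {poly F} :=
  'X^(d - k) * (1 - 'X) ^+ k - ((d%:R * lam) ^- d)%:P.

Definition g_poly (F : fieldType) (d k : nat) (lam : F) : {poly F} :=
  'X^d - (d%:R * lam) *: 'X^k + 1.

Definition num_zeros (F : finFieldType) (P : {poly F}) : nat :=
  #|[set y : F | root P y]|.

Definition r_q (F : finFieldType) (d k : nat) (lam : F) : nat :=
  num_zeros (f_poly d k lam).

Definition r_q' (F : finFieldType) (d k : nat) (lam : F) : nat :=
  num_zeros (g_poly d k lam).

(* Main.v *)
Require Import Defs.
From HB Require Import structures.
From mathcomp Require Import all_boot all_order all_algebra all_field.
From mathcomp Require Import ring.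

(** Write [c = d * lam], which is nonzero because [lam] is and because the
    characteristic of [F] does not divide [d], and [n = d - k].  A zero [x] of [g] is a nonzero
    solution of [x^d + 1 = c x^k]; dividing by [c x^k], this says that
    [y = 1 / (c x^k)] and [x^n / c] add up to [1].  Hence
    [y^n (1 - y)^k = x^(-kn) x^(nk) / c^d = c^(-d)], so that [y] is a zero of
    [f].

    The correspondence [x |-> 1 / (c x^k)] is a bijection from the zeros of [g]
    onto those of [f].  Indeed [y] determines both [x^k = 1 / (c y)] and
    [x^n = c (1 - y)], and the equation of [f] is exactly the compatibility
    relation [(x^k)^n = (x^n)^k] between these two values.  Since [k] and [n]
    are coprime, a Bezout relation shows that a compatible pair of values comes
    from exactly one [x] ([coprime_exp_lift] and [coprime_exp_inj]). *)

Set Implicit Arguments.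
Unset Strict Implicit.
Unset Printing Implicit Defensive.

Import GRing.Theory.
Local Open Scope ring_scope.

(** A Bezout relation [u m = v n + 1] forces [x = W^u / B^v]; the hypothesis
    [W^n = B^m] is what makes this candidate work. *)
Lemma coprime_exp_lift (F : fieldType) (m n : nat) (W B : F) :
  (0 < m)%N -> coprime m n -> B != 0 -> W ^+ n = B ^+ m ->
  exists2 x : F, x ^+ m = W & x ^+ n = B.
Proof.
move=> m_gt0 /eqP cop_mn B_neq0 WnBm.
case: (egcdnP n m_gt0) => u v; rewrite cop_mn => bezout _.
have Bexp_neq0 j : B ^+ j != 0 by rewrite expf_neq0.
exists (W ^+ u / B ^+ v).
  rewrite expr_div_n -!exprM bezout exprD expr1 mulnC [in B ^+ _]mulnC.
  by rewrite [in LHS]exprM WnBm -exprM mulrAC divff ?mul1r.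
rewrite expr_div_n -!exprM mulnC exprM WnBm -exprM mulnC bezout exprD expr1.
by rewrite mulrAC divff ?mul1r.
Qed.

(** The quotient [x / y] is both an [m]-th and an [n]-th root of unity, hence
    trivial by Bezout. *)
Lemma coprime_exp_inj (F : fieldType) (m n : nat) (x y : F) :
  (0 < m)%N -> coprime m n -> y != 0 ->
  x ^+ m = y ^+ m -> x ^+ n = y ^+ n -> x = y.
Proof.
move=> m_gt0 /eqP cop_mn y_neq0 eq_m eq_n.
case: (egcdnP n m_gt0) => u v; rewrite cop_mn => bezout _.
have : (x / y) ^+ (u * m) = (x / y) ^+ (v * n + 1) by rewrite bezout.
rewrite exprD expr1 [(u * m)%N]mulnC [(v * n)%N]mulnC !exprM !expr_div_n.
rewrite eq_m eq_n !divff ?expf_neq0 // mul1r => quot1.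
by rewrite -[x](divfK y_neq0) -quot1 mul1r.
Qed.

Lemma root_f_poly (F : fieldType) (d k : nat) (lam y : F) :
  root (f_poly d k lam) y = (y ^+ (d - k) * (1 - y) ^+ k == (d%:R * lam) ^- d).
Proof. by rewrite /root /f_poly !(hornerE, horner_exp) subr_eq0. Qed.

Lemma root_g_poly (F : fieldType) (d k : nat) (lam x : F) :
  root (g_poly d k lam) x = (x ^+ d + 1 == d%:R * lam * x ^+ k).
Proof. by rewrite /root /g_poly !(hornerE, horner_exp) addrAC subr_eq0. Qed.

Lemma root_g_poly_neq0 (F : fieldType) (d k : nat) (lam x : F) :
  (0 < k)%N -> (0 < d)%N -> root (g_poly d k lam) x -> x != 0.
Proof.
move=> k_gt0 d_gt0; rewrite root_g_poly; apply: contraTneq => ->.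
by rewrite !expr0n !gtn_eqF // mulr0 add0r oner_eq0.
Qed.

(** Dividing [x^d + 1 = c x^k] by [c x^k] gives the complementary coordinate
    [1 - y] of the point [y] attached to [x]. *)
Lemma one_sub_zero_map (F : fieldType) (d k : nat) (c x : F) :
  (k <= d)%N -> c != 0 -> x != 0 -> x ^+ d + 1 = c * x ^+ k ->
  1 - (c * x ^+ k)^-1 = x ^+ (d - k) / c.
Proof.
move=> le_kd c_neq0 x_neq0; rewrite -[in x ^+ d](subnK le_kd) exprD => gx.
have xk_neq0 : x ^+ k != 0 by rewrite expf_neq0.
have -> : 1 = (c * x ^+ k) / (c * x ^+ k) by rewrite divff ?mulf_neq0.
rewrite -[in X in X / _]gx.
by field; rewrite c_neq0 xk_neq0.
Qed.

Theorem corollary1p3 (d k p r : nat) (F : finFieldType) (lam : F)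
    (hk : (1 <= k)%N) (hkd : (k < d)%N)
    (hp : prime p) (hp_odd : odd p)
    (hpdk : ~~ (p %| d * k * (d - k))%N)
    (hr : (1 <= r)%N) (hF : #|F| = (p ^ r)%N)
    (hlam : lam != 0)
    (hgcd : gcdn d k = 1%N) :
  r_q' d k lam = r_q d k lam.
Proof.
have le_kd := ltnW hkd.
have n_gt0 : (0 < d - k)%N by rewrite subn_gt0.
have cop_kn : coprime k (d - k).
  by rewrite /coprime -gcdnDl subnKC // gcdnC hgcd.
have charFp := card_finPcharP hF hp.
have c_neq0 : d%:R * lam != 0.
  rewrite mulf_neq0 // -(dvdn_pcharf charFp).
  by apply: contra hpdk => p_d; rewrite -mulnA dvdn_mulr.
set c := d%:R * lam in c_neq0.
pose phi (x : F) := (c * x ^+ k)^-1.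
have g_neq0 x : root (g_poly d k lam) x -> x != 0.
  exact: root_g_poly_neq0 (ltn_trans hk hkd).
have phi_compl x : root (g_poly d k lam) x -> 1 - phi x = x ^+ (d - k) / c.
  move=> gx; apply: one_sub_zero_map => //; first exact: g_neq0.
  by apply/eqP; rewrite -root_g_poly.
have phi_inj : {in [set x | root (g_poly d k lam) x] &, injective phi}.
  move=> x1 x2; rewrite !inE => gx1 gx2 eq_phi.
  apply: coprime_exp_inj hk cop_kn (g_neq0 _ gx2) _ _.
    exact: (mulfI c_neq0 (invr_inj eq_phi)).
  have cV_neq0 : c^-1 != 0 by rewrite invr_eq0.
  by apply: (mulIf cV_neq0); rewrite -!phi_compl ?eq_phi.
rewrite /r_q' /r_q /num_zeros -(card_in_imset phi_inj).
congr #|pred_of_set _|; apply/setP => y; rewrite inE.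
apply/imsetP/idP => [[x] | fy].
  rewrite inE => gx ->; have x_neq0 := g_neq0 x gx.
  rewrite root_f_poly phi_compl // -/c /phi -[in c ^- d](subnKC le_kd) exprD.
  rewrite exprVn expr_div_n exprMn -!exprM [(k * _)%N]mulnC.
  have X_neq0 : x ^+ ((d - k) * k) != 0 by rewrite expf_neq0.
  have ck_neq0 : c ^+ k != 0 by rewrite expf_neq0.
  have cn_neq0 : c ^+ (d - k) != 0 by rewrite expf_neq0.
  by apply/eqP; field; rewrite X_neq0 ck_neq0 cn_neq0.
move: fy; rewrite root_f_poly -/c => /eqP fy.
have : y ^+ (d - k) * (1 - y) ^+ k != 0 by rewrite fy invr_eq0 expf_neq0.
rewrite mulf_eq0 !expf_eq0 hk n_gt0 /= negb_or => /andP[y_neq0 y1_neq0].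
have compat : (c * y)^-1 ^+ (d - k) = (c * (1 - y)) ^+ k.
  have yn_neq0 : y ^+ (d - k) != 0 by rewrite expf_neq0.
  have cn_neq0 : c ^+ (d - k) != 0 by rewrite expf_neq0.
  rewrite exprVn [(c * y) ^+ _]exprMn [(c * (1 - y)) ^+ _]exprMn.
  apply: (mulfI (mulf_neq0 cn_neq0 yn_neq0)).
  rewrite divff ?mulf_neq0 // mulrACA -exprD subnK // fy.
  by rewrite divff ?expf_neq0.
have [x xk xn] :=
  coprime_exp_lift hk cop_kn (mulf_neq0 c_neq0 y1_neq0) compat.
exists x.
  rewrite inE root_g_poly -/c -[in x ^+ d](subnK le_kd) exprD xk xn.
  by apply/eqP; field; rewrite c_neq0 y_neq0.
by rewrite /phi xk invfM invrK mulKf.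
Qed.
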